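(* Let $z_i^+\in\mathcal I^+$ be the $i$-th post-impact state of the knife-edge billiard in the disk, occurring at time $t_i$, and let $z_{i+1}^-$ be the next pre-impact state, occurring at time $t_{i+1}$. Then $z_{i+1}^-=\mathrm{Ro}(z_i^+)$. Moreover, the elapsed time between the consecutive impacts is $t_{i+1}-t_i=\Delta t(z_i^+)$.
   Context: **Setting.** Let $R,\ell,m,J>0$. The knife-edge is a segment of length $2\ell$, mass $m$, moment of inertia $J$ about its midpoint, with center of mass at the midpoint. A configuration is $q=(\theta,p)\in SE(2)$, with orientation $[\theta]\in\mathbb S^1=\mathbb R/2\pi\mathbb Z$ and midpoint $p=(x,y)\in\mathbb R^2$. Its front and back points are $p_f=p+\ell(\cos\theta,\sin\theta)$ and $p_b=p-\ell(\cos\theta,\sin\theta)$. The table is the closed disk of radius $R$ centered at the origin; the impact surface is $\{h(q)=R^2\}$ with $h(q)=\max\{\|p_f\|^2,\|p_b\|^2\}$. Admissible velocities are $\dot\theta=\omega$, $\dot p=v(\cos\theta,\sin\theta)$ with quasi-velocities $(\omega,v)\in\mathbb R^2$. In the smooth (impact-free) dynamics, $\omega,v$ are constant and $\dot\theta=\omega$, $\dot p=v(\cos\theta,\sin\theta)$. **Impact states.** Write $z=([\phi],[\vartheta],\omega,v)\in\mathbb T^2\times(\mathbb R^2\setminus\{(0,0)\})$, $\mathbb T^2=\mathbb S^1\times\mathbb S^1$. Set $\mathcal I_f=\{z:\ \ell/R<\cos\vartheta\}$ (front-type), $\mathcal I_b=\{z:\ \ell/R<-\cos\vartheta\}$ (back-type),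 $\mathcal I=\mathcal I_f\cup\mathcal I_b$. The point $z$ represents the configuration with $\theta(z)=\phi-\vartheta$ and $p_f=R(\cos\phi,\sin\phi)$ if $z\in\mathcal I_f$ (respectively $p_b=R(\cos\phi,\sin\phi)$ if $z\in\mathcal I_b$), so the midpoint is $p(z)=R(\cos\phi,\sin\phi)\mp\ell(\cos(\phi-\vartheta),\sin(\phi-\vartheta))$ with $-$ for front-type and $+$ for back-type; $(\omega,v)$ are its quasi-velocities. Put $N(z)=\ell\omega\sin\vartheta+v\cos\vartheta$ for $z\in\mathcal I_f$ and $N(z)=v\cos\vartheta-\ell\omega\sin\vartheta$ for $z\in\mathcal I_b$ (the outward radial velocity of the endpoint on the boundary). Regular pre-impact, regular post-impact and tangential states are $\mathcal{RI}^-=\{z\in\mathcal I: N(z)>0\}$, $\mathcal{RI}^+=\{z\in\mathcal I:N(z)<0\}$, $\mathcal{TI}=\{z\in\mathcal I: N(z)=0\}$; $\mathcal I^\pm=\mathcal{RI}^\pm\cup\mathcal{TI}$. **Next impact.** Given $z_i^+\in\mathcal I^+$ at time $t_i$, follow the smooth dynamics from the configuration and quasi-velocities represented by $z_i^+$; $t_{i+1}$ is the first time $t>t_i$ with $h(q(t))=R^2$, and $z_{i+1}^-\in\mathcal I^-$ is the coordinate of the state reached then. **Auxiliary functions.** Let $\mathcal{RI}_v^+=\{z\in\mathcal{RI}^+:\omega=0\}$. For $z\in\mathcal I^+\setminus\mathcal{RI}^+_v$ (where $\omega\ne0$) let $\mathrm c(z)=p(z)+\frac v\omega(-\sin(\phi-\vartheta),\cos(\phi-\vartheta))$,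 $d=\|\mathrm c(z)\|$, $r=\sqrt{(v/\omega)^2+\ell^2}$, $$\alpha=\arccos\frac{d^2+R^2-r^2}{2dR},\quad \beta=\arccos\frac{d^2-R^2+r^2}{2dr},\quad \gamma=\arcsin\frac{\ell}{r}.$$ Define $\Omega:\mathcal I^+\to\mathbb S^1$ by $\Omega(z)=[-2\,\mathrm{sgn}(\omega)\alpha(z)]$ if $z\in\mathcal I^+\setminus\mathcal{RI}_v^+$ and $\Omega(z)=[-2\vartheta+\pi]$ if $z\in\mathcal{RI}_v^+$. The coupled circle map is $\mathrm{Ro}:\mathcal I^+\to\mathcal I^-$, $\mathrm{Ro}(z)=([\phi]+\Omega(z),[-\vartheta+\pi],\omega,v)$. **Time of flight.** A state $z\in\mathcal I^+$ with $\omega v\neq0$ is leading-type if ($z\in\mathcal I_f$ and $v>0$) or ($z\in\mathcal I_b$ and $v<0$), and trailing-type if ($z\in\mathcal I_f$ and $v<0$) or ($z\in\mathcal I_b$ and $v>0$). Define $\Delta t:\mathcal I^+\to(0,\infty)$ by - $\Delta t=\frac{2(\beta+\gamma-\pi)}{|\omega|}$ if $\omega v\ne0$ and $z$ is leading-type; - $\Delta t=\frac{2(\beta-\gamma)}{|\omega|}$ if $\omega v\neq0$ and $z$ is trailing-type; - $\Delta t=\frac{2\beta-\pi}{|\omega|}$ if $v=0$; - $\Delta t=\frac{2(|R\cos\vartheta|-\ell)}{|v|}$ if $z\in\mathcal{RI}^+_v$ (i.e. $\omega=0$). *)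

(* Defs.v *)
(* MathComp-Analysis; the real numbers are an arbitrary realType K, and the
   letter R is kept for the radius of the table. *)
From HB Require Import structures.
From mathcomp Require Export all_boot all_order all_algebra.
From mathcomp Require Export all_classical all_reals all_analysis.

Set Implicit Arguments.
Unset Strict Implicit.
Unset Printing Implicit Defensive.

Export Order.TTheory GRing.Theory Num.Theory.
Export numFieldNormedType.Exports.

Global Open Scope classical_set_scope.
Global Open Scope ring_scope.

Section Circle.
Variable K : realType.

Definition two_piZ : {pred K} :=
  fun x => `[< exists k : int, x = k%:~R * (pi *+ 2) >].

Lemma two_piZ_zmod_closed : zmod_closed two_piZ.
Proof.
split; first by apply/asboolP; exists 0; rewrite mul0r.
move=> x y /asboolP[k ->] /asboolP[l ->]; apply/asboolP.
by exists (k - l); rewrite intrB mulrBl.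
Qed.

HB.instance Definition _ := GRing.isZmodClosed.Build K two_piZ
  two_piZ_zmod_closed.

(* The additive group K / 2 pi Z, with the zmodType structure that the library
   puts on the quotient of a zmodType by a subgroup. *)
Definition circle := ring_quotient.Quotient.quot two_piZ.

Definition angle (x : K) : circle := (\pi_(circle) x)%qT.

Lemma angle_eqP (x y : K) :
  angle x = angle y <-> exists k : int, x - y = k%:~R * (pi *+ 2).
Proof.
have E : (angle x == angle y) = (x - y \in two_piZ).
  by rewrite /angle; exact/esym/ring_quotient.Quotient.idealrBE.
split; first by move/eqP; rewrite E => /asboolP.
by move=> H; apply/eqP; rewrite E; apply/asboolP.
Qed.

Lemma angleD (x y : K) : angle (x + y) = angle x + angle y.
Proof. exact: ring_quotient.pi_addr. Qed.

Lemma angleN (x : K) : angle (- x) = - angle x.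
Proof. exact: ring_quotient.pi_oppr. Qed.

Definition ccos (a : circle) : K := cos (repr a).
Definition csin (a : circle) : K := sin (repr a).

Lemma repr_angle (x : K) :
  exists k : int, repr (angle x) = x + k%:~R * (pi *+ 2).
Proof.
have /angle_eqP[k /eqP] : angle (repr (angle x)) = angle x by exact: reprK.
by rewrite subr_eq addrC => /eqP ->; exists k.
Qed.

Lemma periodic_int (f : K -> K) (T : K) : periodic f T ->
  forall (k : int) x, f (x + k%:~R * T) = f x.
Proof.
move=> fT [n|n] x; first by rewrite -pmulrn mulr_natl (periodicn fT).
rewrite NegzE mulrNz mulNr -pmulrn mulr_natl.
by rewrite -[LHS](periodicn fT n.+1) subrK.
Qed.

Lemma ccos_angle (x : K) : ccos (angle x) = cos x.
Proof.
by rewrite /ccos; have [k ->] := repr_angle x; exact/periodic_int/cosD2pi.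
Qed.

Lemma csin_angle (x : K) : csin (angle x) = sin x.
Proof.
by rewrite /csin; have [k ->] := repr_angle x; exact/periodic_int/sinD2pi.
Qed.

End Circle.

Section Plane.
Variable K : realType.

(* Euclidean norm; the library norm on K * K is the sup norm. *)
Definition enorm (u : K * K) : K := Num.sqrt (u.1 ^+ 2 + u.2 ^+ 2).

Definition dir (a : circle K) : K * K := (ccos a, csin a).
Definition dir_perp (a : circle K) : K * K := (- csin a, ccos a).

End Plane.

Section KnifeEdge.
Variable K : realType.
Variables R ell : K.

Record config := Config { orientation : circle K; midpoint : K * K }.

Definition front (q : config) : K * K :=
  midpoint q + ell *: dir (orientation q).
Definition back (q : config) : K * K :=
  midpoint q - ell *: dir (orientation q).

Definition h (q : config) : K :=
  Num.max (enorm (front q) ^+ 2) (enorm (back q) ^+ 2).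

(* Impact-free motion with quasi-velocities (om, v). The velocity of the
   circle-valued orientation is that of a real-valued lift theta. *)
Definition smooth_motion (om v : K) (q : K -> config) : Prop :=
  exists theta : K -> K, forall t : K,
    [/\ orientation (q t) = angle (theta t),
        is_derive t 1 theta om,
        is_derive t 1 (fun s => (midpoint (q s)).1) (v * cos (theta t)) &
        is_derive t 1 (fun s => (midpoint (q s)).2) (v * sin (theta t))].

Record state := State {
  phi : circle K;
  vartheta : circle K;
  omega : K;
  vel : K;
  quasi_neq0 : (omega, vel) != (0, 0)
}.

Definition I_f : set state := [set z | ell / R < ccos (vartheta z)].
Definition I_b : set state := [set z | ell / R < - ccos (vartheta z)].
Definition I_ : set state := I_f `|` I_b.

Definition theta_of (z : state) : circle K := phi z - vartheta z.

(* Functions given by one formula on I_f and another on I_b are defined by a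
   test on I_f; they are meaningful on I_ only, where I_f and I_b are disjoint
   as soon as R and ell are positive. *)
Definition p_of (z : state) : K * K :=
  if z \in I_f then R *: dir (phi z) - ell *: dir (theta_of z)
  else R *: dir (phi z) + ell *: dir (theta_of z).

Definition config_of (z : state) : config := Config (theta_of z) (p_of z).

Definition N (z : state) : K :=
  if z \in I_f then ell * omega z * csin (vartheta z) + vel z * ccos (vartheta z)
  else vel z * ccos (vartheta z) - ell * omega z * csin (vartheta z).

Definition RI_minus : set state := I_ `&` [set z | 0 < N z].
Definition RI_plus : set state := I_ `&` [set z | N z < 0].
Definition TI : set state := I_ `&` [set z | N z = 0].
Definition I_minus : set state := RI_minus `|` TI.
Definition I_plus : set state := RI_plus `|` TI.

Definition first_impact (q : K -> config) (t t' : K) : Prop :=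
  [/\ t < t', h (q t') = R ^+ 2 &
      forall s, t < s < t' -> h (q s) <> R ^+ 2].

Definition next_impact (z : state) (t : K) (z' : state) (t' : K) : Prop :=
  I_minus z' /\
  exists q : K -> config,
    [/\ smooth_motion (omega z) (vel z) q,
        q t = config_of z,
        first_impact q t t',
        q t' = config_of z' &
        (omega z', vel z') = (omega z, vel z)].

Definition RI_v_plus : set state := RI_plus `&` [set z | omega z = 0].

Definition center (z : state) : K * K :=
  p_of z + (vel z / omega z) *: dir_perp (theta_of z).
Definition d_of (z : state) : K := enorm (center z).
Definition r_of (z : state) : K :=
  Num.sqrt ((vel z / omega z) ^+ 2 + ell ^+ 2).

Definition alpha (z : state) : K :=
  acos ((d_of z ^+ 2 + R ^+ 2 - r_of z ^+ 2) / (2 * d_of z * R)).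
Definition beta (z : state) : K :=
  acos ((d_of z ^+ 2 - R ^+ 2 + r_of z ^+ 2) / (2 * d_of z * r_of z)).
Definition gamma (z : state) : K := asin (ell / r_of z).

Definition Omega (z : state) : circle K :=
  if z \in RI_v_plus then - (vartheta z *+ 2) + angle pi
  else angle (- 2 * Num.sg (omega z) * alpha z).

Definition Ro (z : state) : state :=
  State (phi z + Omega z) (- vartheta z + angle pi) (quasi_neq0 z).

Definition leading : set state :=
  [set z | omega z * vel z != 0 /\
    ((I_f z /\ 0 < vel z) \/ (I_b z /\ vel z < 0))].
Definition trailing : set state :=
  [set z | omega z * vel z != 0 /\
    ((I_f z /\ vel z < 0) \/ (I_b z /\ 0 < vel z))].

(* On I_plus the four cases are exclusive and exhaustive: omega and vel do not
   both vanish, and omega = 0 forces N <> 0. *)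
Definition Delta_t (z : state) : K :=
  if z \in RI_v_plus then
    2 * (`|R * ccos (vartheta z)| - ell) / `|vel z|
  else if vel z == 0 then (2 * beta z - pi) / `|omega z|
  else if z \in leading then 2 * (beta z + gamma z - pi) / `|omega z|
  else if z \in trailing then 2 * (beta z - gamma z) / `|omega z|
  else 0.

End KnifeEdge.

(* Main.v *)
Require Import Defs.
From mathcomp Require Import ring lra.

Set Implicit Arguments.
Unset Strict Implicit.
Unset Printing Implicit Defensive.

(** The impact-free motion with given quasi-velocities is determined by its
    configuration at one time (smooth_motion_unique) and is explicit (flow), so
    everything reduces to following the two endpoints of the edge.

    At an impact state one endpoint, the contact endpoint, is on the boundary
    circle and the other, the free endpoint, is strictly inside (enorm_other).
    If omega <> 0, both endpoints run on the same circle, of radius r around the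
    center of rotation c, at distance d > 0 from the origin. An endpoint whose
    phase on this circle, measured from the ray from c to the origin, is x has
    squared distance d^2 + r^2 - 2 d r cos x from the origin, so it is in the
    open table iff cos x > cos beta. After a rotation by u = |omega| (s - t),
    the contact endpoint, which enters the table, has phase u - beta
    (dist_contact); the free endpoint is some arc 2 g further in the direction
    of travel, with 0 < g < pi (dist_other), and lies inside at u = 0, which
    forces g < beta (half_gap_lt_beta). Hence both endpoints remain inside until
    u = 2 (beta - g), when the free endpoint reaches the exit point
    (rotation_inside). As g is pi - gamma, gamma or pi / 2 for leading-type
    states, trailing-type states and v = 0 (half_gapE), this is the stated time
    of flight. Tangential states are the case beta = pi, and need no separate
    treatment.

    The entry point and the exit point are mirror images in the line through the
    origin and c, and so are the configurations at the two impacts, with the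
    roles of the endpoints exchanged. The contact angle phi therefore changes by
    twice the angle alpha of the triangle at the origin, and vartheta becomes
    pi - vartheta. This is checked in coordinates (rotation_arrival_angle,
    rotation_arrival) after expressing the cosines and sines of alpha and beta
    by the vector from c to the contact endpoint.

    If omega = 0, the endpoints move along a chord of length 2 R |cos vartheta|
    at distance 2 ell from each other, with the same conclusions
    (translation_inside, translation_arrival).

    Conversely a next impact cannot be earlier, since both endpoints are inside,
    nor later, since the boundary is reached at that time; and a configuration
    comes from at most one impact state with given quasi-velocities
    (config_of_inj). *)

(** * Trigonometry on the circle *)

Section Trigonometry.
Variable K : realType.
Implicit Types (a b : circle K) (x y be g w : K).

Lemma angleP a : exists x, a = angle x.
Proof. by exists (repr a); rewrite /angle reprK. Qed.

Lemma ccosD a b : ccos (a + b) = ccos a * ccos b - csin a * csin b.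
Proof.
have [x ->] := angleP a; have [y ->] := angleP b.
by rewrite -angleD !ccos_angle !csin_angle cosD.
Qed.

Lemma csinD a b : csin (a + b) = csin a * ccos b + ccos a * csin b.
Proof.
have [x ->] := angleP a; have [y ->] := angleP b.
by rewrite -angleD !ccos_angle !csin_angle sinD.
Qed.

Lemma ccosN a : ccos (- a) = ccos a.
Proof. by have [x ->] := angleP a; rewrite -angleN !ccos_angle cosN. Qed.

Lemma csinN a : csin (- a) = - csin a.
Proof. by have [x ->] := angleP a; rewrite -angleN !csin_angle sinN. Qed.

Lemma csin2 a : csin a ^+ 2 = 1 - ccos a ^+ 2.
Proof. by rewrite /csin /ccos sin2cos2. Qed.

Lemma angle0 : angle 0 = 0 :> circle K.
Proof. by apply: (@addIr _ (angle 0)); rewrite -angleD !add0r. Qed.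

Lemma ccosDpi a : ccos (a + angle pi) = - ccos a.
Proof. by rewrite ccosD ccos_angle csin_angle cospi sinpi; ring. Qed.

Lemma csinDpi a : csin (a + angle pi) = - csin a.
Proof. by rewrite csinD ccos_angle csin_angle cospi sinpi; ring. Qed.

(** Reduction of x modulo the period to [0, 2 pi[ leaves a y with cos y = 1;
    then sin (y / 2) = 0 with y / 2 in [0, pi[, which forces y = 0. *)
Lemma cos_eq1 x : cos x = 1 -> exists k : int, x = k%:~R * (pi *+ 2).
Proof.
move=> cx1; exists (Num.floor (x / (pi *+ 2))); apply/eqP; rewrite -subr_eq0.
set k := Num.floor _; set y := x - _.
have pi2_gt0 : 0 < pi *+ 2 :> K by rewrite mulrn_wgt0 ?pi_gt0.
have y_ge0 : 0 <= y by rewrite subr_ge0 -ler_pdivlMr // floor_le.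
have y_lt : y < pi *+ 2.
  rewrite ltrBlDr -[X in X + _]mul1r -mulrDl -ltr_pdivrMr //.
  by rewrite addrC -[1]/(1%:~R) -intrD floorD1_gt.
have cy1 : cos y = 1.
  by rewrite /y -mulNr -mulrNz (periodic_int (@cosD2pi K)).
have sy0 : sin (y / 2) = 0.
  apply/eqP; rewrite -sqrf_eq0; apply/eqP.
  have : cos (y / 2 + y / 2) = 1 by rewrite -splitr.
  by rewrite cosD -!expr2 cos2sin2 => E; lra.
rewrite eq_le y_ge0 andbT leNgt; apply/negP => y_gt0.
have : 0 < sin (y / 2) by apply: sin_gt0_pi; apply/andP; split; lra.
by rewrite sy0 ltxx.
Qed.

(** Two angles with the same cosine and sine differ by an angle of cosine 1. *)
Lemma dir_inj : injective (@dir K).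
Proof.
move=> a b; have [x ->] := angleP a; have [y ->] := angleP b.
rewrite /dir !ccos_angle !csin_angle => -[Ec Es].
apply/angle_eqP/cos_eq1; rewrite cosB Ec Es -!expr2; exact: cos2Dsin2.
Qed.

(** A point of the upper unit half-circle has angle acos of its abscissa; this
    evaluates the angles alpha, beta of the triangle of flight and, at the same
    time, provides the bounds on the arguments of acos. *)
Lemma acos_unit_circle x y : x ^+ 2 + y ^+ 2 = 1 -> 0 <= y ->
  [/\ 0 <= acos x <= pi, cos (acos x) = x & sin (acos x) = y].
Proof.
move=> xy1 y_ge0.
have xI : -1 <= x <= 1 by have := sqr_ge0 y => ?; apply/andP; split; nra.
have [? ?] := acos_def xI; split => //.
rewrite sin_acos // (_ : 1 - x ^+ 2 = y ^+ 2); last by rewrite -xy1; ring.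
by rewrite sqrtr_sqr ger0_norm.
Qed.

Lemma cos_double_sub w be :
  cos (w *+ 2 - be) = cos be + 2 * sin w * sin (be - w).
Proof.
by rewrite mulr2n cosB sinB cosD sinD; ring: (sin2cos2 w).
Qed.

(** A point at phase x on the endpoint circle is inside the table iff
    cos be < cos x. Phases are written x = 2 w - be because the difference of
    cosines then factors into two sines with arguments between 0 and pi. *)
Lemma cos_lt_inside w be : 0 < w < be -> be <= pi ->
  cos be < cos (w *+ 2 - be).
Proof.
move=> /andP[w_gt0 w_lt] be_le; rewrite cos_double_sub ltrDl.
by rewrite !mulr_gt0 // sin_gt0_pi //; apply/andP; split; lra.
Qed.

(** Converse of the previous lemma, for a point that is 2 g ahead of the entry
    point: in the same factorization sin g > 0, so sin (be - g) > 0. *)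
Lemma inside_lt_half g be : 0 < g < pi -> 0 <= be <= pi ->
  cos be < cos (g *+ 2 - be) -> g < be.
Proof.
move=> g_itv /andP[be_ge0 be_le]; rewrite cos_double_sub ltrDl.
rewrite pmulr_rgt0; last first.
  by rewrite pmulr_rgt0 //; exact: sin_gt0_pi.
move=> s_gt0; rewrite ltNge; apply/negP => be_le_g.
suff : 0 <= sin (g - be) by rewrite -opprB sinN; lra.
by apply: sin_ge0_pi; move/andP: g_itv => [? ?]; apply/andP; split; lra.
Qed.

End Trigonometry.

(** * Impact-free motion *)

Section Motion.
Variable K : realType.
Implicit Types (om v t s : K) (q : K -> config K).

Lemma is_derive_addr (f : K -> K) (x df c : K) :
  is_derive x 1 f df -> is_derive x 1 (fun s => f s + c) df.
Proof. by move=> /is_deriveD /(_ (is_derive_cst c x 1)); rewrite addr0. Qed.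

Lemma is_derive_scale (f : K -> K) (x df c : K) :
  is_derive x 1 f df -> is_derive x 1 (fun s => c * f s) (c * df).
Proof. by move=> ?; exact: (@is_deriveZ _ _ _ f c). Qed.

Lemma is_derive_affine (t x a om : K) :
  is_derive x 1 (fun s => a + om * (s - t)) om.
Proof.
under eq_fun do rewrite addrC; apply: is_derive_addr.
rewrite -[X in is_derive _ _ _ X]mulr1; apply: is_derive_scale.
by apply: is_derive_addr.
Qed.

Lemma is_derive_eq_cst (f g : K -> K) (df : K -> K) t s :
  (forall x : K, is_derive x 1 f (df x)) ->
  (forall x : K, is_derive x 1 g (df x)) ->
  f t = g t -> f s = g s.
Proof.
move=> fD gD fgt; apply/eqP; rewrite -subr_eq0; apply/eqP.
rewrite -(subrr (g t)) -{1}fgt.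
apply: (@is_derive_0_is_cst _ (f - g) s t) => x.
have := fD x; have := gD x => ? ?; apply: is_derive_eq; exact: subrr.
Qed.

(** The two lifts of the orientation have the same derivative, hence differ by
    a constant multiple of 2 pi; so the velocities of the midpoints agree, and
    then the midpoints too. *)
Lemma smooth_motion_unique om v q1 q2 t s :
  smooth_motion om v q1 -> smooth_motion om v q2 -> q1 t = q2 t ->
  q1 s = q2 s.
Proof.
move=> [th1 H1] [th2 H2] Et.
have /angle_eqP[k Ek] : angle (th1 t) = angle (th2 t).
  by have [<- _ _ _] := H1 t; have [<- _ _ _] := H2 t; rewrite Et.
have Eth x : th1 x = th2 x + k%:~R * (pi *+ 2).
  apply: (@is_derive_eq_cst th1 (fun y => th2 y + k%:~R * (pi *+ 2))
           (cst om) t) => [y|y|]; last by rewrite -Ek; ring.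
    by have [] := H1 y.
  by have [_ ? _ _] := H2 y; exact: is_derive_addr.
have Ecos x : cos (th1 x) = cos (th2 x).
  by rewrite Eth (periodic_int (@cosD2pi K)).
have Esin x : sin (th1 x) = sin (th2 x).
  by rewrite Eth (periodic_int (@sinD2pi K)).
have Eo : orientation (q1 s) = orientation (q2 s).
  have [-> _ _ _] := H1 s; have [-> _ _ _] := H2 s.
  by apply/angle_eqP; exists k; rewrite Eth; ring.
have E1 : (midpoint (q1 s)).1 = (midpoint (q2 s)).1.
  apply: (@is_derive_eq_cst (fun x => (midpoint (q1 x)).1)
           (fun x => (midpoint (q2 x)).1) (fun x => v * cos (th1 x)) t)
    => [x|x|]; last by rewrite Et.
    by have [] := H1 x.
  by rewrite Ecos; have [] := H2 x.
have E2 : (midpoint (q1 s)).2 = (midpoint (q2 s)).2.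
  apply: (@is_derive_eq_cst (fun x => (midpoint (q1 x)).2)
           (fun x => (midpoint (q2 x)).2) (fun x => v * sin (th1 x)) t)
    => [x|x|]; last by rewrite Et.
    by have [] := H1 x.
  by rewrite Esin; have [] := H2 x.
move: Eo E1 E2; case: (q1 s) (q2 s) => [a1 [x1 y1]] [a2 [x2 y2]] /=.
by move=> -> -> ->.
Qed.

(** The midpoint moves on a line if om = 0, and otherwise on a circle of radius
    |v / om| around midpoint q0 + (v / om) dir_perp (orientation q0). *)
Definition flow om v (q0 : config K) (u : K) : config K :=
  let th := orientation q0 + angle (om * u) in
  Config th
    (if om == 0 then midpoint q0 + (v * u) *: dir th
     else midpoint q0 + (v / om) *: dir_perp (orientation q0)
          - (v / om) *: dir_perp th).

Lemma flow0 om v (q0 : config K) : flow om v q0 0 = q0.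
Proof.
rewrite /flow !mulr0 angle0 addr0.
by case: q0 => a p /=; rewrite scale0r addr0 addrK if_same.
Qed.

Lemma smooth_motion_flow om v (q0 : config K) t :
  smooth_motion om v (fun s => flow om v q0 (s - t)).
Proof.
have [a Ea] := angleP (orientation q0).
pose th s := a + om * (s - t).
have thD s : is_derive s 1 th om.
  exact: is_derive_affine.
have cE s : ccos (orientation q0 + angle (om * (s - t))) = cos (th s).
  by rewrite Ea -angleD ccos_angle.
have sE s : csin (orientation q0 + angle (om * (s - t))) = sin (th s).
  by rewrite Ea -angleD csin_angle.
exists th => s; split => //; first by rewrite /= Ea -angleD.
- rewrite /flow /dir /dir_perp /=; case: eqP => [om0|/eqP om0] /=.
    rewrite (_ : (fun _ => _) =
        fun x => (midpoint q0).1 + (v * cos (th s)) * (x - t)); last first.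
      by apply/funext => x; rewrite cE /th om0 !mul0r /GRing.scale /=; ring.
    exact: is_derive_affine.
  rewrite (_ : (fun _ => _) = fun x => v / om * sin (th x) +
      ((midpoint q0).1 - v / om * csin (orientation q0))); last first.
    by apply/funext => x; rewrite sE /GRing.scale /=; ring.
  apply: is_derive_addr.
  rewrite (_ : v * cos (th s) = v / om * (cos (th s) * om)); last by field.
  by apply: is_derive_scale; exact: (@is_derive1_comp _ sin th).
- rewrite /flow /dir /dir_perp /=; case: eqP => [om0|/eqP om0] /=.
    rewrite (_ : (fun _ => _) =
        fun x => (midpoint q0).2 + (v * sin (th s)) * (x - t)); last first.
      by apply/funext => x; rewrite sE /th om0 !mul0r /GRing.scale /=; ring.
    exact: is_derive_affine.
  rewrite (_ : (fun _ => _) = fun x => - (v / om) * cos (th x) +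
      ((midpoint q0).2 + v / om * ccos (orientation q0))); last first.
    by apply/funext => x; rewrite cE /GRing.scale /=; ring.
  apply: is_derive_addr.
  rewrite (_ : v * sin (th s) = - (v / om) * (- sin (th s) * om));
    last by field.
  by apply: is_derive_scale; exact: (@is_derive1_comp _ cos th).
Qed.

End Motion.

(** * Impact states and their configurations *)

Section Contact.
Variable K : realType.
Variables R ell : K.
Hypotheses (R_gt0 : 0 < R) (ell_gt0 : 0 < ell).
Implicit Types (q : config K) (z : state K) (s : K).

Lemma enorm_sqr (u : K * K) : enorm u ^+ 2 = u.1 ^+ 2 + u.2 ^+ 2.
Proof. by rewrite sqr_sqrtr // addr_ge0 ?sqr_ge0. Qed.

(** A sign s selects the front (s = 1) or the back (s = -1), so that both types
    of impact states are handled by the same formulas. *)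
Definition endpoint q s : K * K :=
  midpoint q + (s * ell) *: dir (orientation q).

Lemma h_endpoint q s : s = 1 \/ s = -1 ->
  h ell q = Num.max (enorm (endpoint q s) ^+ 2) (enorm (endpoint q (- s)) ^+ 2).
Proof.
rewrite /h /front /back /endpoint.
case=> ->; rewrite ?opprK mulN1r mul1r scaleNr //.
by rewrite maxC.
Qed.

(** The sign of the endpoint that touches the boundary. *)
Definition side z : K := if z \in I_f R ell then 1 else -1.

Lemma sideP z : side z = 1 \/ side z = -1.
Proof. by rewrite /side; case: ifP; [left|right]. Qed.

Lemma side2 z : side z ^+ 2 = 1.
Proof. by case: (sideP z) => ->; ring. Qed.

Lemma I_side z : I_ R ell z -> ell < R * (side z * ccos (vartheta z)).
Proof.
rewrite -ltr_pdivrMl // [R^-1 * _]mulrC /side.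
case: ifPn => [/set_mem|/negP zf [fz|//]]; first by rewrite mul1r.
  by case: zf; exact: mem_set.
by rewrite mulN1r.
Qed.

Lemma side_eq z s : s = 1 \/ s = -1 -> ell < R * (s * ccos (vartheta z)) ->
  I_ R ell z /\ side z = s.
Proof.
rewrite -ltr_pdivrMl // [R^-1 * _]mulrC => s1 lt_s.
have e_gt0 : 0 < ell / R by rewrite divr_gt0.
case: s1 lt_s => ->; rewrite ?mul1r ?mulN1r => lt_s.
  by split; [left | rewrite /side mem_set].
split; first by right.
rewrite /side ifF //; apply/negP => /set_mem; rewrite /I_f /= => ?; lra.
Qed.

Lemma endpoint_contact z :
  endpoint (config_of R ell z) (side z) = R *: dir (phi z).
Proof.
rewrite /endpoint /side /= /p_of; case: ifP => _.
  by rewrite mul1r subrK.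
by rewrite mulN1r scaleNr addrK.
Qed.

Lemma p_of_side z :
  p_of R ell z = R *: dir (phi z) - (side z * ell) *: dir (theta_of z).
Proof. by rewrite -endpoint_contact /endpoint /= addrK. Qed.

Lemma N_side z : N R ell z =
  side z * ell * omega z * csin (vartheta z) + vel z * ccos (vartheta z).
Proof. by rewrite /N /side; case: ifP => _; ring. Qed.

Lemma ccos_theta_of z : ccos (theta_of z) =
  ccos (phi z) * ccos (vartheta z) + csin (phi z) * csin (vartheta z).
Proof. by rewrite /theta_of ccosD ccosN csinN; ring. Qed.

Lemma csin_theta_of z : csin (theta_of z) =
  csin (phi z) * ccos (vartheta z) - ccos (phi z) * csin (vartheta z).
Proof. by rewrite /theta_of csinD ccosN csinN; ring. Qed.

Lemma enorm_contact z :
  enorm (endpoint (config_of R ell z) (side z)) ^+ 2 = R ^+ 2.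
Proof.
rewrite endpoint_contact enorm_sqr /= /GRing.scale /=.
by ring: (csin2 (phi z)).
Qed.

(** The squared distance of the free endpoint from the origin is
    R^2 - 4 ell (R |cos vartheta| - ell). *)
Lemma enorm_other z : I_ R ell z ->
  enorm (endpoint (config_of R ell z) (- side z)) ^+ 2 < R ^+ 2.
Proof.
move=> /I_side lt_ell; rewrite enorm_sqr /endpoint /= p_of_side /=.
rewrite /GRing.scale /= ccos_theta_of csin_theta_of.
rewrite [ltLHS](_ : _ = R ^+ 2
    - 4 * ell * (R * (side z * ccos (vartheta z)) - ell)); last first.
  by ring: (csin2 (phi z)) (csin2 (vartheta z)) (side2 z).
by rewrite gtrBl !mulr_gt0 // subr_gt0.
Qed.

Lemma h_config_of z : I_ R ell z -> h ell (config_of R ell z) = R ^+ 2.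
Proof.
move=> zI; rewrite (h_endpoint _ (sideP z)) enorm_contact.
by apply/max_idPl/ltW/enorm_other.
Qed.

(** Only one endpoint is on the boundary, so the configuration determines the
    type of the state; the position of that endpoint then gives phi, and the
    orientation gives vartheta. *)
Lemma config_of_inj z1 z2 : I_ R ell z1 -> I_ R ell z2 ->
  config_of R ell z1 = config_of R ell z2 ->
  (omega z1, vel z1) = (omega z2, vel z2) -> z1 = z2.
Proof.
move=> zI1 zI2 Eq Ew.
have Es : side z1 = side z2.
  have [//|/esym E] : side z1 = side z2 \/ - side z2 = side z1.
    by case: (sideP z1) (sideP z2) => -> [] ->; rewrite ?opprK; auto.
  have := enorm_other zI2; rewrite -Eq -E enorm_contact.
  by rewrite ltxx.
have Ephi : phi z1 = phi z2.
  apply: dir_inj; apply: (scalerI (lt0r_neq0 R_gt0)).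
  by rewrite -!endpoint_contact Eq Es.
have Evt : vartheta z1 = vartheta z2.
  by case: Eq => + _; rewrite /theta_of Ephi => /addrI/oppr_inj.
move: Ephi Evt Ew; clear.
case: z1 z2 => [p1 a1 o1 v1 n1] [p2 a2 o2 v2 n2] /= -> -> E.
case: E n1 n2 => -> -> n1 n2; congr State; exact: eq_irrelevance.
Qed.

Lemma I_plusP z : I_plus R ell z -> I_ R ell z /\ N R ell z <= 0.
Proof. by move=> [[zI /ltW]|[zI /=->]]. Qed.

(** Replacing vartheta by pi - vartheta changes the sign of its cosine, which
    exchanges the roles of the front and the back. *)
Lemma side_Ro z : I_ R ell z ->
  I_ R ell (Ro R ell z) /\ side (Ro R ell z) = - side z.
Proof.
move=> /I_side lt_ell; apply: side_eq.
  by case: (sideP z) => ->; rewrite ?opprK; auto.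
by rewrite /= ccosDpi ccosN mulrNN.
Qed.

(** Ro changes both the side and the sign of cos vartheta and keeps
    sin vartheta, so the outward radial velocity changes sign. *)
Lemma I_minus_Ro z : I_plus R ell z -> I_minus R ell (Ro R ell z).
Proof.
move=> /I_plusP[zI Nz]; have [RI Rs] := side_Ro zI.
have EN : N R ell (Ro R ell z) = - N R ell z.
  rewrite !N_side Rs /= ccosDpi csinDpi ccosN csinN.
  by ring.
move: Nz; rewrite le_eqVlt => /orP[/eqP N0|N_lt0]; [right|left]; split => //=.
  by rewrite EN N0 oppr0.
by rewrite EN oppr_gt0.
Qed.

Lemma endpoint_flow_rot z u s : omega z != 0 ->
  let th := theta_of z + angle (omega z * u) in
  endpoint (flow (omega z) (vel z) (config_of R ell z) u) s =
  center R ell z - (vel z / omega z) *: dir_perp th + (s * ell) *: dir th.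
Proof. by move=> om0 th; rewrite /endpoint /flow (negPf om0) /=. Qed.

End Contact.

(** * Flight with nonzero angular velocity *)

Section Rotation.
Variable K : realType.
Variables (R ell : K) (z : state K).
Hypotheses (R_gt0 : 0 < R) (ell_gt0 : 0 < ell).
Hypotheses (z_plus : I_plus R ell z) (om0 : omega z != 0).

Local Notation sd := (side R ell z).
Local Notation eps := (Num.sg (omega z)).
Local Notation lam := (vel z / omega z).
Local Notation C := (ccos (vartheta z)).
Local Notation S := (csin (vartheta z)).
Local Notation d := (d_of R ell z).
Local Notation r := (r_of ell z).
Local Notation al := (alpha R ell z).
Local Notation be := (beta R ell z).

(** In the orthonormal frame (dir phi, dir_perp phi) the vector from the center
    of rotation to the contact endpoint is (arm_rad, - arm_tan). *)
Definition arm_rad : K := sd * ell * C - lam * S.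
Definition arm_tan : K := lam * C + sd * ell * S.

Let eps2 : eps ^+ 2 = 1.
Proof. by rewrite sqr_sg om0. Qed.

Let absom_gt0 : 0 < `|omega z|. Proof. by rewrite normr_gt0. Qed.

Lemma r_sqr : r ^+ 2 = lam ^+ 2 + ell ^+ 2.
Proof. by rewrite sqr_sqrtr // addr_ge0 ?sqr_ge0. Qed.

Lemma r_gt0 : 0 < r.
Proof. by rewrite sqrtr_gt0 ltr_wpDl ?sqr_ge0 ?exprn_gt0. Qed.

Lemma arm_sqr : arm_rad ^+ 2 + arm_tan ^+ 2 = r ^+ 2.
Proof.
by rewrite r_sqr /arm_rad /arm_tan; ring: (csin2 (vartheta z)) (side2 R ell z).
Qed.

Lemma center_polar :
  center R ell z = (R - arm_rad) *: dir (phi z) + arm_tan *: dir_perp (phi z).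
Proof.
rewrite /center p_of_side // /dir /dir_perp ccos_theta_of csin_theta_of.
by congr (_, _); rewrite /= /GRing.scale /= /arm_rad /arm_tan; ring.
Qed.

Lemma d_sqr : d ^+ 2 = (R - arm_rad) ^+ 2 + arm_tan ^+ 2.
Proof.
rewrite /d_of enorm_sqr center_polar /= /GRing.scale /=.
by ring: (csin2 (phi z)).
Qed.

(** If the center of rotation were the origin, both endpoints would be at
    distance R from the origin; analytically, ell = R |cos vartheta|. *)
Lemma d_gt0 : 0 < d.
Proof.
rewrite lt0r sqrtr_ge0 andbT; apply/negP => /eqP d0.
have := d_sqr; rewrite d0 expr0n /= => /esym/eqP.
rewrite paddr_eq0 ?sqr_ge0 // !sqrf_eq0 => /andP[/eqP Em /eqP En].
have [/(I_side R_gt0) + _] := I_plusP z_plus.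
have key : sd * (arm_rad * C + arm_tan * S) = ell.
  by rewrite /arm_rad /arm_tan; ring: (csin2 (vartheta z)) (side2 R ell z).
have -> : R * (sd * C) = sd * (arm_rad * C + arm_tan * S)
    + (R - arm_rad) * (sd * C) - sd * (arm_tan * S) by ring.
by rewrite key Em En !mul0r mulr0 subr0 addr0 ltxx.
Qed.

(** The outward radial velocity of the contact endpoint is omega arm_tan. *)
Lemma arm_tan_sg : eps * arm_tan <= 0.
Proof.
have [_ Nz] := I_plusP z_plus.
have : `|omega z| * (eps * arm_tan) <= 0.
  apply: le_trans Nz; rewrite mulrA [`|_| * _]mulrC -numEsg N_side.
  by rewrite le_eqVlt; apply/orP; left; apply/eqP; rewrite /arm_tan; field.
by rewrite (pmulr_rle0 _ absom_gt0).
Qed.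

(** Here alpha is the angle at the origin of the triangle formed by the origin,
    the center of rotation and the contact endpoint. *)
Lemma alphaP : cos al = (R - arm_rad) / d /\ sin al = - (eps * arm_tan) / d.
Proof.
have [d0 R0] := (lt0r_neq0 d_gt0, lt0r_neq0 R_gt0).
rewrite /alpha.
have -> : (d ^+ 2 + R ^+ 2 - r ^+ 2) / (2 * d * R) = (R - arm_rad) / d.
  rewrite -arm_sqr d_sqr; field; exact/andP.
have [] // := @acos_unit_circle _ ((R - arm_rad) / d) (- (eps * arm_tan) / d).
  rewrite !expr_div_n -mulrDl sqrrN exprMn eps2 mul1r -d_sqr divff //.
  by rewrite sqrf_eq0.
by rewrite divr_ge0 ?oppr_ge0 ?arm_tan_sg ?ltW ?d_gt0.
Qed.

(** Here beta is the angle at the center of rotation of the same triangle. *)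
Lemma betaP : [/\ 0 <= be <= pi, d * r * cos be = r ^+ 2 - R * arm_rad &
  d * r * sin be = - (eps * R * arm_tan)].
Proof.
have [d0 r0] := (lt0r_neq0 d_gt0, lt0r_neq0 r_gt0).
rewrite /beta.
have -> : (d ^+ 2 - R ^+ 2 + r ^+ 2) / (2 * d * r)
    = (r ^+ 2 - R * arm_rad) / (d * r).
  have -> : d ^+ 2 - R ^+ 2 + r ^+ 2 = 2 * (r ^+ 2 - R * arm_rad).
    by rewrite d_sqr -arm_sqr; ring.
  by field; exact/andP.
have [] := @acos_unit_circle _ ((r ^+ 2 - R * arm_rad) / (d * r))
  (- (eps * R * arm_tan) / (d * r)).
- rewrite !expr_div_n -mulrDl exprMn d_sqr -!arm_sqr.
  have -> : (arm_rad ^+ 2 + arm_tan ^+ 2 - R * arm_rad) ^+ 2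
      + (- (eps * R * arm_tan)) ^+ 2 =
      ((R - arm_rad) ^+ 2 + arm_tan ^+ 2) * (arm_rad ^+ 2 + arm_tan ^+ 2).
    by ring: eps2.
  by rewrite divff // arm_sqr -d_sqr mulf_neq0 ?sqrf_eq0.
- rewrite divr_ge0 ?mulr_ge0 ?(ltW d_gt0) ?(ltW r_gt0) //.
  by rewrite mulrAC oppr_ge0 pmulr_lle0 // arm_tan_sg.
by move=> ? -> ->; split => //; field; exact/andP.
Qed.

(** Half of the arc of the endpoint circle from the contact endpoint to the free
    one, in the direction of travel. It lies in ]0, pi[, and replaces
    the three cases (leading, trailing, v = 0) of the time of flight. *)
Definition half_gap : K := acos (- (sd * eps * lam) / r).

Lemma half_gapP :
  [/\ 0 < half_gap < pi, cos half_gap = - (sd * eps * lam) / r &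
      sin half_gap = ell / r].
Proof.
have r0 := lt0r_neq0 r_gt0.
have [] := @acos_unit_circle _ (- (sd * eps * lam) / r) (ell / r).
- rewrite !expr_div_n -mulrDl sqrrN !exprMn eps2 side2 !mul1r.
  by rewrite -exprMn -r_sqr divff // sqrf_eq0.
- by rewrite divr_ge0 ?ltW ?r_gt0.
rewrite -/half_gap => /andP[g_ge0 g_le] cg sg; split => //.
have sg_gt0 : 0 < sin half_gap by rewrite sg divr_gt0 ?r_gt0.
rewrite !lt_neqAle g_ge0 g_le !andbT; apply/andP; split; apply/eqP => E.
  by move: sg_gt0; rewrite -E sin0 ltxx.
by move: sg_gt0; rewrite E sinpi ltxx.
Qed.

Lemma cos_sg (x : K) : cos (eps * x) = cos x /\ sin (eps * x) = eps * sin x.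
Proof.
have /eqP := eps2; rewrite sqrf_eq1 => /orP[] /eqP ->.
  by rewrite !mul1r.
by rewrite !mulN1r cosN sinN.
Qed.

(** Time is measured by the angle u = |omega| (s - t) of rotation. *)
Let turn (u : K) := flow (omega z) (vel z) (config_of R ell z) (u / `|omega z|).

Let om_turn (u : K) : omega z * (u / `|omega z|) = eps * u.
Proof.
rewrite {1}[omega z]numEsg; field; exact: lt0r_neq0.
Qed.

(** The law of cosines: at angle u the contact endpoint has phase u - be
    relative to the ray from the center of rotation to the origin. *)
Lemma dist_contact u : enorm (endpoint ell (turn u) sd) ^+ 2 =
  d ^+ 2 + r ^+ 2 - 2 * (d * r * cos (u - be)).
Proof.
have [_ cb sb] := betaP; have [cu su] := cos_sg u.
have -> : d * r * cos (u - be) =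
    cos u * (d * r * cos be) + sin u * (d * r * sin be).
  by rewrite cosB; ring.
rewrite cb sb enorm_sqr /turn endpoint_flow_rot // om_turn center_polar /=.
rewrite /dir /dir_perp !(ccosD (theta_of z)) !(csinD (theta_of z)).
rewrite !ccos_angle !csin_angle !ccos_theta_of !csin_theta_of cu su d_sqr r_sqr.
rewrite /= /GRing.scale /=.
rewrite /arm_rad /arm_tan.
by ring: (csin2 (phi z)) (csin2 (vartheta z)) (side2 R ell z) eps2 (sin2cos2 u).
Qed.

(** The free endpoint is on the same circle, 2 half_gap ahead. *)
Lemma dist_other u : enorm (endpoint ell (turn u) (- sd)) ^+ 2 =
  d ^+ 2 + r ^+ 2 - 2 * (d * r * cos (u + half_gap *+ 2 - be)).
Proof.
have r0 := lt0r_neq0 r_gt0.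
have [_ cb sb] := betaP; have [cu su] := cos_sg u.
have [_ cg sg] := half_gapP.
have -> : d * r * cos (u + half_gap *+ 2 - be) =
    cos (u + half_gap *+ 2) * (d * r * cos be)
    + sin (u + half_gap *+ 2) * (d * r * sin be).
  by rewrite cosB; ring.
have c2g : cos (half_gap *+ 2) = (lam ^+ 2 - ell ^+ 2) / r ^+ 2.
  by rewrite mulr2n cosD cg sg; field: eps2 (side2 R ell z); exact/andP.
have s2g : sin (half_gap *+ 2) = - (2 * sd * eps * lam * ell) / r ^+ 2.
  by rewrite mulr2n sinD cg sg; field: eps2 (side2 R ell z); exact/andP.
have rr0 : lam ^+ 2 + ell ^+ 2 != 0 by rewrite -r_sqr sqrf_eq0.
rewrite cb sb enorm_sqr /turn endpoint_flow_rot // om_turn center_polar /=.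
rewrite cosD sinD c2g s2g.
rewrite /dir /dir_perp !(ccosD (theta_of z)) !(csinD (theta_of z)).
rewrite !ccos_angle !csin_angle !ccos_theta_of !csin_theta_of cu su d_sqr r_sqr.
rewrite /= /GRing.scale /=.
move: rr0; rewrite /arm_rad /arm_tan; move: lam => l0 rr0.
by field: (csin2 (phi z)) (csin2 (vartheta z)) (side2 R ell z) eps2
  (sin2cos2 u).
Qed.

Lemma R_sqr : R ^+ 2 = d ^+ 2 + r ^+ 2 - 2 * (d * r * cos be).
Proof. by have [_ -> _] := betaP; rewrite d_sqr -arm_sqr; ring. Qed.

Lemma dist_lt (x : K) : cos be < cos x ->
  d ^+ 2 + r ^+ 2 - 2 * (d * r * cos x) < R ^+ 2.
Proof.
by move=> lt_cos; rewrite R_sqr ltrD2l ltrN2 !ltr_pM2l ?mulr_gt0 ?d_gt0 ?r_gt0.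
Qed.

(** The free endpoint is inside the table at the time of impact. *)
Lemma half_gap_lt_beta : half_gap < be.
Proof.
have [be_itv _ _] := betaP; have [g_itv _ _] := half_gapP.
apply: inside_lt_half => //; rewrite ltNge; apply/negP => le_cos.
have [zI _] := I_plusP z_plus.
have := dist_other 0; rewrite /turn mul0r flow0 add0r => E.
have := enorm_other R_gt0 ell_gt0 zI; rewrite E R_sqr ltrD2l ltrN2.
by rewrite !ltr_pM2l ?mulr_gt0 ?d_gt0 ?r_gt0 // ltNge le_cos.
Qed.

(** The contact endpoint is inside for 0 < u < 2 be, the free endpoint as long
    as u + 2 half_gap < 2 be. *)
Lemma rotation_inside (u : K) : 0 < u < 2 * (be - half_gap) ->
  h ell (turn u) < R ^+ 2.
Proof.
move=> /andP[u_gt0 u_lt].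
have [/andP[be_ge0 be_le] _ _] := betaP.
have [/andP[g_gt0 g_lt] _ _] := half_gapP.
rewrite (h_endpoint _ _ (sideP R ell z)) dist_contact dist_other gt_max.
have Eu : u = (u / 2) *+ 2 by rewrite mulr2n -splitr.
apply/andP; split; apply: dist_lt; rewrite Eu -?mulrnDl.
  by apply: cos_lt_inside => //; apply/andP; split; lra.
by apply: cos_lt_inside => //; apply/andP; split; lra.
Qed.

(** By the angle sum of the triangle, pi - alpha - beta is the angle at the
    contact endpoint between the directions of the origin and of the center,
    while the edge makes the angle vartheta with the former and an angle known
    from half_gap with the latter. *)
Lemma chord_angle :
  cos (al + be - half_gap) = - (eps * sd * S) /\
  sin (al + be - half_gap) = sd * C.
Proof.
have [d0 r0] := (lt0r_neq0 d_gt0, lt0r_neq0 r_gt0).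
have [ca sa] := alphaP; have [_ cb sb] := betaP.
have [_ cg sg] := half_gapP.
have d2_0 : (R - arm_rad) ^+ 2 + arm_tan ^+ 2 != 0 by rewrite -d_sqr sqrf_eq0.
have {}cb : cos be = (r ^+ 2 - R * arm_rad) / (d * r).
  by rewrite -cb; field; rewrite ?d0 ?r0.
have {}sb : sin be = - (eps * R * arm_tan) / (d * r).
  by rewrite -sb; field; rewrite ?d0 ?r0.
have cab : cos (al + be) = - arm_rad / r.
  rewrite cosD ca sa cb sb -arm_sqr.
  rewrite [LHS](_ : _ = - arm_rad
     * ((R - arm_rad) ^+ 2 + arm_tan ^+ 2) / (d ^+ 2 * r)); last first.
    by field: eps2; rewrite ?d0 ?r0.
  by rewrite -d_sqr; field; rewrite ?d0 ?r0.
have sab : sin (al + be) = - (eps * arm_tan) / r.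
  rewrite sinD ca sa cb sb -arm_sqr.
  rewrite [LHS](_ : _ = - (eps * arm_tan)
     * ((R - arm_rad) ^+ 2 + arm_tan ^+ 2) / (d ^+ 2 * r)); last first.
    by field; rewrite ?d0 ?r0.
  by rewrite -d_sqr; field; rewrite ?d0 ?r0.
have rr0 : lam ^+ 2 + ell ^+ 2 != 0 by rewrite -r_sqr sqrf_eq0.
rewrite cosB sinB cab sab cg sg.
have -> : - arm_rad / r * (- (sd * eps * lam) / r)
    + - (eps * arm_tan) / r * (ell / r) =
    (arm_rad * (sd * eps * lam) - eps * arm_tan * ell) / r ^+ 2.
  by field; rewrite ?r0 ?om0.
have -> : - (eps * arm_tan) / r * (- (sd * eps * lam) / r)
    - - arm_rad / r * (ell / r) =
    (eps * arm_tan * (sd * eps * lam) + arm_rad * ell) / r ^+ 2.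
  by field; rewrite ?r0 ?om0.
rewrite r_sqr /arm_rad /arm_tan; move: lam rr0 => l0 rr0.
by split; field: (side2 R ell z) eps2 (csin2 (vartheta z)).
Qed.

(** Up to the sign of omega, the edge turns by 2 (be - half_gap) and the contact
    angle phi by - 2 alpha; by chord_angle the difference is 2 vartheta - pi. *)
Lemma rotation_arrival_angle :
  theta_of z + angle (eps * (2 * (be - half_gap))) = theta_of (Ro R ell z).
Proof.
have := chord_angle; set x := al + be - half_gap => -[cx sx].
have E : angle (eps * ((al + be - half_gap) *+ 2)) = vartheta z *+ 2 - angle pi.
  apply: dir_inj; rewrite /dir -angleN [vartheta z *+ 2]mulr2n.
  rewrite !ccosD !csinD !ccos_angle !csin_angle cosN sinN cospi sinpi.
  have [-> ->] := cos_sg (x *+ 2).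
  rewrite mulr2n (cosD x) (sinD x) cx sx oppr0.
  by congr pair; ring: (csin2 (vartheta z)) (side2 R ell z) eps2.
rewrite /theta_of /= /Omega ifF; last first.
  by apply/negP => /set_mem[_ /= /eqP]; rewrite (negPf om0).
have -> : eps * (2 * (be - half_gap)) =
    eps * (x *+ 2) + -2 * eps * al by rewrite /x; ring.
rewrite angleD E [- vartheta z + angle pi]addrC opprB mulr2n -!addrA addKr.
by rewrite [angle _ + (_ - _)]addrC -addrA.
Qed.

(** The center of rotation has coordinates (R - arm_rad, arm_tan) in the frame
    at the angle phi and, by the mirror symmetry, (R - arm_rad, - arm_tan) in
    the frame at the angle of arrival. *)
Lemma rotation_arrival :
  turn (2 * (be - half_gap)) = config_of R ell (Ro R ell z).
Proof.
have [zI _] := I_plusP z_plus.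
have d0 := lt0r_neq0 d_gt0.
have [ca sa] := alphaP.
have [RI Rs] := side_Ro R_gt0 ell_gt0 zI.
rewrite /turn /flow om_turn (negPf om0) /= rotation_arrival_angle.
congr Config.
rewrite [p_of R ell (Ro R ell z)]p_of_side Rs.
have -> : p_of R ell z + lam *: dir_perp (theta_of z) = center R ell z by [].
rewrite center_polar.
set ph := phi (Ro R ell z).
have [cp sp] : ccos ph = cos (al *+ 2) * ccos (phi z)
      + eps * sin (al *+ 2) * csin (phi z)
    /\ csin ph = cos (al *+ 2) * csin (phi z)
      - eps * sin (al *+ 2) * ccos (phi z).
  rewrite /ph /= /Omega ifF; last first.
    by apply/negP => /set_mem[_ /= /eqP]; rewrite (negPf om0).
  rewrite ccosD csinD !ccos_angle !csin_angle.
  have -> : -2 * eps * al = - (eps * (al *+ 2)) by ring.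
  rewrite cosN sinN (cos_sg _).1 (cos_sg _).2.
  by split; ring.
have d2_0 : (R - arm_rad) ^+ 2 + arm_tan ^+ 2 != 0 by rewrite -d_sqr sqrf_eq0.
have c2a : cos (al *+ 2) = ((R - arm_rad) ^+ 2 - arm_tan ^+ 2)
    / ((R - arm_rad) ^+ 2 + arm_tan ^+ 2).
  by rewrite -d_sqr mulr2n cosD ca sa; field: eps2; rewrite ?d0.
have s2a : eps * sin (al *+ 2) = - (2 * arm_tan * (R - arm_rad))
    / ((R - arm_rad) ^+ 2 + arm_tan ^+ 2).
  by rewrite -d_sqr mulr2n sinD ca sa; field: eps2; rewrite ?d0.
have [ct st] : ccos (theta_of (Ro R ell z)) = - (ccos ph * C - csin ph * S)
    /\ csin (theta_of (Ro R ell z)) = - (csin ph * C + ccos ph * S).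
  rewrite ccos_theta_of csin_theta_of -/ph /=.
  rewrite ccosDpi csinDpi ccosN csinN.
  by split; ring.
have aux : R *: dir ph + (sd * ell) *: dir (theta_of (Ro R ell z))
    + lam *: dir_perp (theta_of (Ro R ell z)) =
    (R - arm_rad) *: dir ph - arm_tan *: dir_perp ph.
  rewrite /dir /dir_perp ct st.
  by congr pair; rewrite /= /GRing.scale /= /arm_rad /arm_tan; ring.
apply/eqP; rewrite subr_eq mulNr scaleNr opprK aux; apply/eqP.
rewrite /dir /dir_perp cp sp c2a s2a.
by congr pair; rewrite /= /GRing.scale /=; field.
Qed.

End Rotation.

(** * Time of flight *)

Section Elapsed.
Variable K : realType.
Variables (R ell : K) (z : state K).
Hypotheses (R_gt0 : 0 < R) (ell_gt0 : 0 < ell).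
Hypotheses (z_plus : I_plus R ell z).
Local Notation sd := (side R ell z).

Lemma I_f_side : I_f R ell z <-> sd = 1.
Proof.
rewrite /side; split=> [zf|]; first by rewrite mem_set.
by case: ifPn => [/set_mem //|_ E]; lra.
Qed.

Lemma I_b_side : I_b R ell z <-> sd = -1.
Proof.
have [zI _] := I_plusP z_plus; split.
  rewrite /I_b /= ltr_pdivrMr // => lt_ell.
  suff [] : I_ R ell z /\ sd = -1 by [].
  by apply: side_eq => //; [right | rewrite mulN1r mulrC].
by case: zI => // /I_f_side -> ?; lra.
Qed.

Lemma leading_side : omega z * vel z != 0 ->
  (z \in leading R ell) = (0 < sd * vel z).
Proof.
move=> ov0; apply/idP/idP.
  move=> /set_mem[_ [[/I_f_side -> ?]|[/I_b_side -> ?]]]; lra.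
move=> H; apply: mem_set; split => //; move: H.
have [E|E] := sideP R ell z; rewrite E ?mul1r ?mulN1r ?oppr_gt0 => ?.
  by left; split => //; apply/I_f_side.
by right; split => //; apply/I_b_side.
Qed.

Lemma trailing_side : omega z * vel z != 0 ->
  (z \in trailing R ell) = (sd * vel z < 0).
Proof.
move=> ov0; apply/idP/idP.
  move=> /set_mem[_ [[/I_f_side -> ?]|[/I_b_side -> ?]]]; lra.
move=> H; apply: mem_set; split => //; move: H.
have [E|E] := sideP R ell z; rewrite E ?mul1r ?mulN1r ?oppr_lt0 => ?.
  by left; split => //; apply/I_f_side.
by right; split => //; apply/I_b_side.
Qed.

(** In fact gamma lies in [0, pi / 2]; [0, pi] is the domain on which acos
    inverts cos. *)
Lemma gammaP : 0 <= gamma ell z <= pi /\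
  cos (gamma ell z) = `|vel z / omega z| / r_of ell z.
Proof.
have r_gt0 := @r_gt0 _ _ z ell_gt0.
have r0 := lt0r_neq0 r_gt0.
have unit : (`|vel z / omega z| / r_of ell z) ^+ 2
    + (ell / r_of ell z) ^+ 2 = 1.
  rewrite !expr_div_n -mulrDl (real_normK (num_real _)) -r_sqr divff //.
  by rewrite sqrf_eq0.
have lr_gt0 : 0 < ell / r_of ell z by rewrite divr_gt0.
have lr_le : ell / r_of ell z <= 1.
  rewrite -(@ler_pXn2r _ 2) ?nnegrE ?(ltW lr_gt0) // expr1n -unit lerDr.
  exact: sqr_ge0.
have lrI : -1 <= ell / r_of ell z <= 1 by apply/andP; split => //; lra.
have [/andP[g_ge g_le] sE] := asin_def lrI; split.
  have pi_gt0 := pi_gt0 K.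
  rewrite /gamma; set g := asin _ in g_ge g_le sE *.
  apply/andP; split; last by lra.
  rewrite leNgt; apply/negP => g_lt0.
  suff : 0 < sin (- g) by rewrite sinN sE; lra.
  by apply: sin_gt0_pi; apply/andP; split; lra.
rewrite /gamma cos_asin // -[in X in X - _]unit addrK sqrtr_sqr ger0_norm //.
by rewrite divr_ge0 // ltW.
Qed.

(** The endpoints are 2 gamma apart on their circle. If the contact endpoint
    leads, the free one is reached only by going round the other way. *)
Lemma half_gapE : omega z != 0 -> half_gap R ell z =
  if vel z == 0 then pi / 2
  else if 0 < sd * vel z then pi - gamma ell z else gamma ell z.
Proof.
move=> om0; rewrite /half_gap.
have pi_gt0 := pi_gt0 K.
have Nom0 : `|omega z| != 0 by rewrite normr_eq0.
have [g_itv cg] := gammaP.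
have E : sd * Num.sg (omega z) * (vel z / omega z) = sd * vel z / `|omega z|.
  rewrite {2}[omega z]numEsg; field.
  by rewrite ?Nom0 ?sgr_eq0 ?om0.
have Nsd : `|vel z| = `|sd * vel z|.
  by case: (sideP R ell z) => ->; rewrite ?mul1r ?mulN1r ?normrN.
move: cg; rewrite normf_div Nsd E => cg.
have [v0|v0] := eqVneq (vel z) 0.
  rewrite v0 mulr0 mul0r oppr0 mul0r -cos_pihalf cosK // in_itv /=.
  by apply/andP; split; lra.
have sv0 : sd * vel z != 0.
  rewrite mulf_neq0 //.
  by case: (sideP R ell z) => ->; rewrite ?oppr_eq0 oner_eq0.
case: ltP => [sv|sv].
  have -> : - (sd * vel z / `|omega z|) / r_of ell z = cos (pi - gamma ell z).
    by rewrite [pi - _]addrC cosDpi cosN cg (gtr0_norm sv) mulNr.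
  rewrite cosK // in_itv /=; move/andP: g_itv => [? ?].
  by apply/andP; split; lra.
have -> : - (sd * vel z / `|omega z|) / r_of ell z = cos (gamma ell z).
  by rewrite cg (ler0_norm sv) !mulNr.
by rewrite cosK.
Qed.

Lemma Delta_tE : omega z != 0 ->
  Delta_t R ell z = 2 * (beta R ell z - half_gap R ell z) / `|omega z|.
Proof.
move=> om0; rewrite half_gapE // /Delta_t ifF; last first.
  by apply/negP => /set_mem[_ /= /eqP]; rewrite (negPf om0).
have [_|v0] /= := eqVneq (vel z) 0.
  by field; rewrite normr_eq0.
have ov0 : omega z * vel z != 0 by rewrite mulf_neq0.
rewrite leading_side // trailing_side //.
have sv0 : sd * vel z != 0.
  rewrite mulf_neq0 //.
  by case: (sideP R ell z) => ->; rewrite ?oppr_eq0 oner_eq0.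
by case: ltgtP sv0 => // _ _; field; rewrite normr_eq0.
Qed.

End Elapsed.

(** * Flight with zero angular velocity *)

Section Translation.
Variable K : realType.
Variables (R ell : K) (z : state K).
Hypotheses (R_gt0 : 0 < R) (ell_gt0 : 0 < ell).
Hypotheses (z_plus : I_plus R ell z) (om0 : omega z = 0).
Local Notation sd := (side R ell z).
Local Notation C := (ccos (vartheta z)).

(** The contact endpoint moves away from the boundary, so a front contact moves
    backwards and a back contact forwards. *)
Lemma translation_vel : sd * vel z = - `|vel z| /\ 0 < `|vel z|.
Proof.
have [zI Nz] := I_plusP z_plus.
have sC_gt0 : 0 < sd * C.
  by rewrite -(pmulr_rgt0 _ R_gt0); apply: lt_trans (I_side R_gt0 zI).
have v0 : vel z != 0.
  by apply: contraNneq (quasi_neq0 z) => v0; rewrite om0 v0.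
split; last by rewrite normr_gt0.
have : (sd * C) * (sd * vel z) <= 0.
  rewrite mulrACA -expr2 side2 mul1r mulrC.
  by move: Nz; rewrite N_side om0 mulr0 mul0r add0r.
rewrite pmulr_rle0 // => sv; apply/oppr_inj; rewrite opprK -ler0_norm //.
by case: (sideP R ell z) => ->; rewrite ?mul1r ?mulN1r ?normrN.
Qed.

(** A tangential state has omega <> 0: otherwise N = v cos vartheta. *)
Lemma in_RI_v_plus : z \in RI_v_plus R ell.
Proof.
apply: mem_set; split => //; case: z_plus => // -[zI /= N0].
have [sv v_gt0] := translation_vel.
have := I_side R_gt0 zI; move: N0; rewrite N_side om0 mulr0 mul0r add0r.
move=> /eqP; rewrite mulf_eq0 -normr_eq0 (gt_eqF v_gt0) /= => /eqP ->.
by rewrite !mulr0 => ?; have := ell_gt0; lra.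
Qed.

Lemma Delta_t_translation :
  Delta_t R ell z = 2 * (R * (sd * C) - ell) / `|vel z|.
Proof.
rewrite /Delta_t in_RI_v_plus (_ : `|R * _| = R * (sd * C)) //.
have [zI _] := I_plusP z_plus.
have := lt_trans ell_gt0 (I_side R_gt0 zI) => RsC.
rewrite -[RHS]gtr0_norm // !normrM.
by case: (sideP R ell z) => ->; rewrite ?normrN normr1 mul1r.
Qed.

(** Time is measured by the distance x = |v| (s - t). *)
Let slide (x : K) := flow (omega z) (vel z) (config_of R ell z) (x / `|vel z|).

Lemma slideE (x : K) :
  slide x = Config (theta_of z) (p_of R ell z - (sd * x) *: dir (theta_of z)).
Proof.
have [sv v_gt0] := translation_vel.
have v0 := lt0r_neq0 v_gt0.
rewrite /slide /flow om0 eqxx mul0r /= angle0 addr0 -scaleNr.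
congr (Config _ (_ + _ *: _)).
have -> : vel z = - (sd * `|vel z|).
  by rewrite -mulrN -sv mulrA -expr2 side2 mul1r.
rewrite normrN normrM normr_id.
by case: (sideP R ell z) => ->; rewrite ?normrN normr1; field.
Qed.

(** The endpoints move on a chord of length 2 R |cos vartheta|; the free
    endpoint is 2 ell ahead of the contact endpoint. *)
Lemma translation_inside (x : K) : 0 < x < 2 * (R * (sd * C) - ell) ->
  h ell (slide x) < R ^+ 2.
Proof.
move=> /andP[x_gt0 x_lt]; rewrite (h_endpoint _ _ (sideP R ell z)) slideE.
rewrite !enorm_sqr /endpoint /= p_of_side /= /GRing.scale /=.
rewrite !ccos_theta_of !csin_theta_of gt_max; apply/andP; split.
  rewrite [ltLHS](_ : _ = R ^+ 2 - x * (2 * (R * (sd * C)) - x)).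
    by rewrite gtrBl mulr_gt0 //; have := ell_gt0; lra.
  by ring: (csin2 (phi z)) (csin2 (vartheta z)) (side2 R ell z).
rewrite [ltLHS](_ : _ = R ^+ 2
    - (x + 2 * ell) * (2 * (R * (sd * C)) - (x + 2 * ell))).
  by have := ell_gt0 => ?; rewrite gtrBl mulr_gt0 //; lra.
by ring: (csin2 (phi z)) (csin2 (vartheta z)) (side2 R ell z).
Qed.

Lemma translation_arrival :
  slide (2 * (R * (sd * C) - ell)) = config_of R ell (Ro R ell z).
Proof.
have [zI _] := I_plusP z_plus.
have [RI Rs] := side_Ro R_gt0 ell_gt0 zI.
have Eth : theta_of (Ro R ell z) = theta_of z.
  rewrite /theta_of /= /Omega in_RI_v_plus [- vartheta z + angle pi]addrC opprB.
  rewrite mulr2n opprD -!addrA [angle pi + _]addrC subrK.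
  by rewrite addNr addr0.
rewrite slideE /config_of Eth [p_of R ell (Ro R ell z)]p_of_side Rs Eth.
congr Config; rewrite p_of_side /= /Omega in_RI_v_plus mulr2n opprD.
rewrite /dir ccos_theta_of csin_theta_of.
rewrite !csinD !ccosD !csinD !ccosN !csinN ccos_angle csin_angle cospi sinpi.
congr pair; rewrite /= /GRing.scale /=.
  by ring: (csin2 (vartheta z)) (side2 R ell z).
by ring: (csin2 (vartheta z)) (side2 R ell z).
Qed.

End Translation.

(** * The next impact *)

Section NextImpact.
Variable K : realType.
Variables (R ell : K) (z : state K).
Hypotheses (R_gt0 : 0 < R) (ell_gt0 : 0 < ell).
Hypothesis z_plus : I_plus R ell z.

Let trajectory (u : K) := flow (omega z) (vel z) (config_of R ell z) u.

(** Until the time Delta_t both endpoints are strictly inside, and at this time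
    the configuration is the one coded by Ro. *)
Lemma flight : [/\ 0 < Delta_t R ell z,
  forall u, 0 < u < Delta_t R ell z -> h ell (trajectory u) < R ^+ 2 &
  trajectory (Delta_t R ell z) = config_of R ell (Ro R ell z)].
Proof.
have [om0|om0] := eqVneq (omega z) 0.
  have [_ v_gt0] := translation_vel R_gt0 ell_gt0 z_plus om0.
  have [zI _] := I_plusP z_plus.
  have gap : 0 < 2 * (R * (side R ell z * ccos (vartheta z)) - ell).
    by rewrite mulr_gt0 // subr_gt0; exact: I_side.
  rewrite Delta_t_translation //; split.
  - by rewrite divr_gt0.
  - move=> u /andP[u_gt0]; rewrite ltr_pdivlMr // => u_lt.
    rewrite /trajectory -[u](mulfK (lt0r_neq0 v_gt0)).
    apply: translation_inside => //.
    by rewrite mulr_gt0.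
  - exact: translation_arrival.
have om_gt0 : 0 < `|omega z| by rewrite normr_gt0.
have g_lt := half_gap_lt_beta R_gt0 ell_gt0 z_plus om0.
rewrite Delta_tE //; split.
- by rewrite divr_gt0 ?mulr_gt0 ?subr_gt0.
- move=> u /andP[u_gt0]; rewrite ltr_pdivlMr // => u_lt.
  rewrite /trajectory -[u](mulfK (lt0r_neq0 om_gt0)).
  apply: rotation_inside => //.
  by rewrite mulr_gt0.
- exact: rotation_arrival.
Qed.

End NextImpact.

Theorem theorem1 (K : realType) (R ell m J : K)
  (R_gt0 : 0 < R) (ell_gt0 : 0 < ell) (m_gt0 : 0 < m) (J_gt0 : 0 < J)
  (z : state K) (t : K) (z_plus : I_plus R ell z) :
  (exists (z' : state K) (t' : K), next_impact R ell z t z' t') /\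
  (forall (z' : state K) (t' : K), next_impact R ell z t z' t' ->
     z' = Ro R ell z /\ t' - t = Delta_t R ell z).
Proof.
have [D_gt0 inside arrival] := flight R_gt0 ell_gt0 z_plus.
have [zI _] := I_plusP z_plus.
have [RI _] := side_Ro R_gt0 ell_gt0 zI.
set D := Delta_t R ell z in D_gt0 inside arrival *.
split.
  exists (Ro R ell z), (t + D); split; first exact: I_minus_Ro.
  exists (fun s => flow (omega z) (vel z) (config_of R ell z) (s - t)).
  split => //.
  - exact: smooth_motion_flow.
  - by rewrite subrr flow0.
  - split; first by rewrite ltrDl.
      by rewrite addrC addKr arrival h_config_of.
    move=> s /andP[ts sD]; apply/eqP; rewrite lt_eqF // inside //.
    by rewrite subr_gt0 ts ltrBlDl.
  - by rewrite addrC addKr.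
move=> z' t' [z'_minus [q [qM qt [tt' ht' first] qt' Ew]]].
have qE s : q s = flow (omega z) (vel z) (config_of R ell z) (s - t).
  have fM := smooth_motion_flow (omega z) (vel z) (config_of R ell z) t.
  apply: (@smooth_motion_unique _ _ _ q _ t s qM fM).
  by rewrite qt subrr flow0.
have z'I : I_ R ell z' by case: z'_minus => -[].
have Et : t' - t = D.
  apply/eqP; rewrite eq_le.
  apply/andP; split; rewrite leNgt; apply/negP => lt_D.
    apply: (first (t + D)); first by rewrite ltrDl D_gt0 -ltrBrDl.
    by rewrite qE addrC addKr arrival h_config_of.
  have := inside (t' - t); rewrite subr_gt0 tt' lt_D -qE ht' ltxx.
  by move=> /(_ isT).
split=> //; apply: (config_of_inj R_gt0 ell_gt0 z'I RI _ Ew).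
by rewrite -qt' qE Et.
Qed.
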